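(* Suppose $|\mathcal{I}_H|>k$ and, for a given $i_0\in\{0,1,\dots,k-1\}$, the weights satisfy $$f(a_L+(i_0+1)a_H)-f(a_L+i_0a_H)\le\frac{f(ka_H)-f(i_0a_H)}{k-i_0}$$ (this always holds when $i_0=k-1$). The exact lifting coefficients $\gamma_j$, $j\in\{|\mathcal{I}_H|+1,\dots,n\}$ (the optimal values of the lifting problems defined in the context), are $$\gamma_j=\begin{cases}\gamma^{[k-1]},& j=|\mathcal{I}_H|+1,\\ \min\{\gamma_{j-1},\ \gamma^{L^{t}\cup[k-1-t]}\},& j=|\mathcal{I}_H|+1+t,\ t\in[n-1-|\mathcal{I}_H|].\end{cases}$$
   Context: $[j]=\{1,\dots,j\}$ for integers $j\ge1$, and $[0]=\emptyset$. $N=[n]$, $k\ge1$ is the cardinality bound, and $f:\mathbb{R}\to\mathbb{R}$ is concave with $f(0)=0$. The weight vector $a\in\mathbb{R}^n_+$ has exactly two distinct values $0\le a_L<a_H$; the items are indexed so that $\mathcal{I}_H=\{i:a_i=a_H\}=\{1,\dots,|\mathcal{I}_H|\}$ and $\mathcal{I}_L=\{i:a_i=a_L\}=\{|\mathcal{I}_H|+1,\dots,n\}$. $L^t=\{|\mathcal{I}_H|+1,\dots,|\mathcal{I}_H|+t\}$ is the set of the first $t$ lower-weighted items ($L^0=\emptyset$). The base separation inequality (SI) over $\mathcal{I}_H$ with parameter $i_0$ (and the natural ordering of $\mathcal{I}_H$) is $w\ge\sum_{i=1}^{i_0}\rho_ix_i+\sum_{i=i_0+1}^{|\mathcal{I}_H|}\psi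 x_i$, where $\rho_i=f(ia_H)-f((i-1)a_H)$ and $\psi=\frac{f(ka_H)-f(i_0a_H)}{k-i_0}$. The higher-separation inequality (higher-SI) lifted from it is $w\ge\sum_{i=1}^{i_0}\rho_ix_i+\sum_{i=i_0+1}^{|\mathcal{I}_H|}\psi x_i+\sum_{j=|\mathcal{I}_H|+1}^n\gamma_jx_j$, where, sequentially for $j=|\mathcal{I}_H|+1,\dots,n$, $\gamma_j$ is the optimal value of the $j$-th lifting problem: minimize $w-\sum_{i=1}^{i_0}\rho_ix_i-\sum_{i=i_0+1}^{|\mathcal{I}_H|}\psi x_i-\sum_{i=|\mathcal{I}_H|+1}^{j-1}\gamma_ix_i$ subject to $w\ge f(a_L+\sum_{i=1}^{j-1}a_ix_i)$, $\sum_{i=1}^{j-1}x_i\le k-1$, $x\in\{0,1\}^{j-1}$. The best objective value at an $x$ with support $X=\{i\in[j-1]:x_i=1\}$ is denoted $$\gamma^X=f\Big(a_L+\sum_{i\in X}a_i\Big)-\sum_{i\in X,\,i\le i_0}\rho_i-\sum_{i\in X,\,i_0<i\le |\mathcal{I}_H|}\psi-\sum_{i\in X,\,i>|\mathcal{I}_H|}\gamma_i .$$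
   Formalization: For t ≥ k the set [k-1-t] is undefined (and reading it as empty makes the formula false, e.g. k=1, f strictly concave, a_L>0); the formal theorem states the min formula for t < k and γ_j = γ_{j-1} for t ≥ k. *)

(* Defs.v *)
From HB Require Import structures.
From mathcomp Require Import all_boot all_order all_algebra.
From mathcomp Require Import classical_sets reals convex.

Set Implicit Arguments.
Unset Strict Implicit.
Unset Printing Implicit Defensive.

Import Order.TTheory GRing.Theory Num.Theory.

Local Open Scope ring_scope.

(* The ordinal [i : 'I_n] stands for the item numbered [i.+1] in the set
   {1, ..., n}; thus "item number <= m" reads [(i < m)%N]. *)

Definition concave_function (R : realType) (f : R -> R) : Prop :=
  @convex_function R R^o [set: R^o]%classic (fun x => - f x).

Definition is_optimal_value (R : realType) (T : Type)
    (feasible : T -> Prop) (objective : T -> R) (v : R) : Prop :=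
  (exists2 p, feasible p & objective p = v) /\
  (forall p, feasible p -> v <= objective p).

Section TwoWeights.
Variables (R : realType) (n : nat) (a : 'I_n -> R) (aL aH : R).

Definition itemsH : {set 'I_n} := [set i | a i == aH]%SET.
Definition itemsL : {set 'I_n} := [set i | a i == aL]%SET.

Definition two_weights : Prop :=
  [/\ 0 <= aL, aL < aH, (exists i, a i = aL), (exists i, a i = aH)
    & forall i, a i = aL \/ a i = aH].

Definition natural_indexing : Prop :=
  itemsH = [set i : 'I_n | (i < #|itemsH|)%N]%SET /\
  itemsL = [set i : 'I_n | (#|itemsH| <= i)%N]%SET.

(* [firstN m] is {1, ..., m} and [firstL t] consists of the first [t]
   lower-weighted items. *)
Definition firstN (m : nat) : {set 'I_n} := [set i : 'I_n | (i < m)%N]%SET.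

Definition firstL (t : nat) : {set 'I_n} :=
  [set i : 'I_n | (#|itemsH| <= i < #|itemsH| + t)%N]%SET.

End TwoWeights.

Section Lifting.
Variables (R : realType) (n k i0 : nat) (f : R -> R).
Variables (a : 'I_n -> R) (aL aH : R) (gamma : 'I_n -> R).

Local Notation h := #|itemsH a aH|.

Definition rho (m : nat) : R := f (m%:R * aH) - f ((m%:R - 1) * aH).

Definition psi : R := (f (k%:R * aH) - f (i0%:R * aH)) / (k%:R - i0%:R).

Definition weight_condition : Prop :=
  f (aL + (i0%:R + 1) * aH) - f (aL + i0%:R * aH) <= psi.

(* Lifting problem of the item [j]: only the coordinates of [x] at the items
   preceding [j] are used, so that [x] represents a point of {0,1}^(number of
   items preceding j). *)
Definition lifting_feasible (j : 'I_n) (p : R * {ffun 'I_n -> bool}) : Prop :=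
  let: (w, x) := p in
  f (aL + \sum_(i < n | (i < j)%N) a i * (x i)%:R) <= w /\
  (\sum_(i < n | (i < j)%N) x i <= k.-1)%N.

Definition lifting_objective (j : 'I_n) (p : R * {ffun 'I_n -> bool}) : R :=
  let: (w, x) := p in
  w - \sum_(i < n | (i < i0)%N) rho i.+1 * (x i)%:R
    - \sum_(i < n | (i0 <= i < h)%N) psi * (x i)%:R
    - \sum_(i < n | (h <= i < j)%N) gamma i * (x i)%:R.

(* The objective for [j] only involves [gamma] at items preceding [j], so
   this determines [gamma] sequentially on the lower-weighted items. *)
Definition lifting_coefficients : Prop :=
  forall j : 'I_n, (h <= j)%N ->
    is_optimal_value (lifting_feasible j) (lifting_objective j) (gamma j).

Definition gamma_of (X : {set 'I_n}) : R :=
  f (aL + \sum_(i in X) a i)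
    - \sum_(i in X | (i < i0)%N) rho i.+1
    - \sum_(i in X | (i0 <= i < h)%N) psi
    - \sum_(i in X | (h <= i)%N) gamma i.

End Lifting.

Lemma lifting_objective_eq (R : realType) (n k i0 : nat) (f : R -> R)
    (a : 'I_n -> R) (aL aH : R) (g1 g2 : 'I_n -> R) (j : 'I_n) p :
  (forall i : 'I_n, (i < j)%N -> g1 i = g2 i) ->
  lifting_objective k i0 f a aH g1 j p = lifting_objective k i0 f a aH g2 j p.
Proof.
case: p => w x e; rewrite /lifting_objective; congr (_ - _).
by apply: eq_bigr => i /andP[_ lij]; rewrite e.
Qed.

Lemma lifting_optimum_exists (R : realType) (n k i0 : nat) (f : R -> R)
    (a : 'I_n -> R) (aL aH : R) (gamma : 'I_n -> R) (j : 'I_n) :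
  exists v, is_optimal_value (lifting_feasible k f a aL j)
    (lifting_objective k i0 f a aH gamma j) v.
Proof.
pose P (x : {ffun 'I_n -> bool}) := (\sum_(i < n | (i < j)%N) x i <= k.-1)%N.
pose W (x : {ffun 'I_n -> bool}) :=
  f (aL + \sum_(i < n | (i < j)%N) a i * (x i)%:R).
pose M x := lifting_objective k i0 f a aH gamma j (W x, x).
have P0 : P [ffun=> false] by rewrite /P big1 // => i _; rewrite ffunE.
case: (Order.TotalTheory.arg_minP M P0) => x Px xmin.
exists (M x); split; first by exists (W x, x).
move=> [w y] [Ww Py]; apply: le_trans (xmin y Py) _.
by rewrite /M /lifting_objective !lerD2r.
Qed.

Lemma lifting_coefficients_exist (R : realType) (n k i0 : nat) (f : R -> R)
    (a : 'I_n -> R) (aL aH : R) :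
  exists gamma, lifting_coefficients k i0 f a aL aH gamma.
Proof.
have key m : exists gamma, forall j : 'I_n, (j < m)%N ->
    is_optimal_value (lifting_feasible k f a aL j)
      (lifting_objective k i0 f a aH gamma j) (gamma j); last first.
  by have [g gP] := key n; exists g => j _; apply: gP.
elim: m => [|m [g gP]]; first by exists (fun=> 0).
have [mn|nm] := ltnP m n; last first.
  by exists g => j _; apply/gP/(leq_trans (ltn_ord j)).
have [v vP] := lifting_optimum_exists k i0 f a aL aH g (Ordinal mn).
exists (fun i : 'I_n => if i == m :> nat then v else g i) => j; rewrite ltnS => jm.
have e p : lifting_objective k i0 f a aH
    (fun i : 'I_n => if i == m :> nat then v else g i) j p =
    lifting_objective k i0 f a aH g j p.
  apply: lifting_objective_eq => // i ij.
  by rewrite ltn_eqF // (leq_trans ij).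
suff [[p pf pv] lb] : is_optimal_value (lifting_feasible k f a aL j)
    (lifting_objective k i0 f a aH g j) (if j == m :> nat then v else g j).
  by split=> [|q qf]; [exists p; rewrite ?e | rewrite e; exact: lb].
case: eqP => [jE|/eqP jE]; last by apply: gP; rewrite ltn_neqAle jE.
by have -> : j = Ordinal mn by exact: val_inj.
Qed.

(* Main.v *)
(* Let the support X of a feasible point have s higher-weighted and u
   lower-weighted items. The coefficients rho_1 >= ... >= rho_i0 >= psi and the
   gamma_j (minima over growing feasible sets) are nonincreasing, so replacing X
   by [s] together with L^u keeps the weight and can only lower gamma^X. By
   concavity and the weight condition, adding the item s+1 to [s] does not
   increase gamma^X either, so the cardinality bound may be taken tight:
   s = k-1-u. Hence gamma_(h+1+t), with h = |I_H|, is the minimum of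
   gamma^(L^u + [k-1-u]) over u <= min(t, k-1), and going from t-1 to t adds
   only the candidate u = t. *)
Require Import Defs.
From mathcomp Require Import all_boot all_order all_algebra.
From mathcomp Require Import classical_sets reals convex.
From mathcomp Require Import interval_inference zify ring lra.

Set Implicit Arguments.
Unset Strict Implicit.
Unset Printing Implicit Defensive.

Import Order.TTheory GRing.Theory Num.Theory.

Local Open Scope ring_scope.

Lemma concave_increments (R : realType) (f : R -> R) (x y d : R) :
  concave_function f -> x <= y -> 0 <= d ->
  f (y + d) - f y <= f (x + d) - f x.
Proof.
move=> fconc xy d0.
have [e|e] := eqVneq (y - x + d) 0.
  by have -> : y = x; lra.
have e0 : 0 < y - x + d by rewrite lt_def e /=; lra.
pose t := d / (y - x + d).
have t0 : 0 <= t by rewrite divr_ge0 // ltW.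
have t1 : t <= 1 by rewrite ler_pdivrMr // mul1r; lra.
have conv_at (u v : R) :
    t * f u + (1 - t) * f v <= f (t * u + (1 - t) * v).
  have /= := @fconc (Itv01 t0 t1) u v (in_setT _) (in_setT _).
  by rewrite !convRE /unstable.onem /= => H; rewrite -lerN2 (le_trans H) //; lra.
have := conv_at x (y + d); have := conv_at (y + d) x.
have -> : t * (y + d) + (1 - t) * x = x + d by rewrite /t; field.
have -> : t * x + (1 - t) * (y + d) = y by rewrite /t; field.
lra.
Qed.

Lemma ler_sum_exchange (R : realDomainType) (T : finType) (A B : {set T})
    (c : T -> R) :
  #|A| = #|B| ->
  (forall x y, x \in A :\: B -> y \in B :\: A -> c x <= c y) ->
  \sum_(i in A) c i <= \sum_(i in B) c i.
Proof.
move=> cAB le_c.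
have cD : #|A :\: B| = #|B :\: A|.
  by apply: (@addnI #|A :&: B|); rewrite cardsID finset.setIC cardsID.
rewrite (big_setID B) /= (big_setID (A := B) A) /= finset.setIC lerD2l.
have [AB0|[x0 x0P]] := set_0Vmem (A :\: B).
  have BA0 : B :\: A = finset.set0.
    by apply/eqP; rewrite -cards_eq0 -cD AB0 cards0.
  by rewrite AB0 BA0 !big_set0.
have [x xP xmax] := arg_maxP c x0P.
apply: (@le_trans _ _ (\sum_(i in A :\: B) c x)); first exact: ler_sum.
by rewrite sumr_const cD -sumr_const; apply: ler_sum => y; apply: le_c.
Qed.

Lemma card_ord_itv (n m l : nat) :
  (m + l <= n)%N -> #|[set i : 'I_n | (m <= i < m + l)%N]%SET| = l.
Proof.
move=> mln; rewrite -sum1_card.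
transitivity (\sum_(m <= i < m + l) 1)%N; last first.
  by rewrite sum_nat_const_nat addKn muln1.
rewrite (big_nat_widen _ _ n) // big_geq_mkord.
by apply: eq_bigl => i; rewrite inE andbC.
Qed.

Section TwoWeightLifting.
Variables (R : realType) (n k i0 : nat) (f : R -> R).
Variables (a : 'I_n -> R) (aL aH : R) (gamma : 'I_n -> R) (h : nat).
Local Notation rho := (rho f aH).
Local Notation psi := (psi k i0 f aH).
Local Notation gamma_of := (gamma_of k i0 f a aL aH gamma).

(* An abstract [h], since the occurrences of [#|itemsH a aH|] are elaborated
   differently and [lia] does not identify them. *)
Hypothesis hE : #|itemsH a aH| = h.
Hypothesis k_gt0 : (0 < k)%N.
Hypothesis fconc : concave_function f.
Hypothesis weights : two_weights a aL aH.
Hypothesis indexing : natural_indexing a aL aH.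
Hypothesis kh : (k < h)%N.
Hypothesis i0k : (i0 < k)%N.
Hypothesis gamma_lifting : lifting_coefficients k i0 f a aL aH gamma.

(* The coefficient of x_(i+1) in the higher-SI. *)
Definition coefficient (i : 'I_n) : R :=
  if (i < i0)%N then rho i.+1 else if (i < h)%N then psi else gamma i.

Let aL0 : 0 <= aL. Proof. by case: weights. Qed.
Let aH0 : 0 <= aH.
Proof. by case: weights => a0 aLH _ _ _; rewrite (le_trans a0) // ltW. Qed.
Let i0h : (i0 <= h)%N. Proof. lia. Qed.
Let h_leqn : (h <= n)%N.
Proof. by rewrite -hE -[X in (_ <= X)%N]card_ord max_card. Qed.

Let gammaP (j : 'I_n) : (h <= j)%N ->
  is_optimal_value (lifting_feasible k f a aL j)
    (lifting_objective k i0 f a aH gamma j) (gamma j).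
Proof. by rewrite -hE; apply: gamma_lifting. Qed.

Lemma weight_H (i : 'I_n) : (i < h)%N -> a i = aH.
Proof.
move=> ih; case: indexing => /setP/(_ i) + _.
by rewrite !inE hE ih => /eqP.
Qed.

Lemma weight_L (i : 'I_n) : (h <= i)%N -> a i = aL.
Proof.
move=> ih; case: indexing => _ /setP/(_ i).
by rewrite !inE hE ih => /eqP.
Qed.

Lemma weight_ge0 i : 0 <= a i.
Proof. by case: (ltnP i h) => [/weight_H|/weight_L] ->. Qed.

Lemma rhoS m : rho m.+1 = f (m.+1%:R * aH) - f (m%:R * aH).
Proof. by rewrite /Defs.rho -natr1 addrK. Qed.

Lemma rho_homo m p : (m <= p)%N -> rho p.+1 <= rho m.+1.
Proof.
move=> mp; rewrite !rhoS -!natr1 !mulrDl !mul1r.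
by apply: concave_increments => //; rewrite ler_wpM2r // ler_nat.
Qed.

Lemma psi_le_rho m : (m <= i0)%N -> psi <= rho m.+1.
Proof.
move=> mi; have ki0 : (i0 <= k)%N by apply: ltnW.
rewrite /Defs.psi -natrB // ler_pdivrMr ?ltr0n ?subn_gt0 //.
rewrite -(telescope_sumr (fun p => f (p%:R * aH))) //.
rewrite mulr_natr -sumr_const_nat; apply: ler_sum_nat => p /andP[ip _].
by rewrite -rhoS; apply: rho_homo; apply: leq_trans ip.
Qed.

Lemma coefficient_H_homo (i j : 'I_n) :
  (i <= j)%N -> (j < h)%N -> coefficient j <= coefficient i.
Proof.
move=> ij jh; rewrite /coefficient jh (leq_ltn_trans ij jh).
case: ltnP => ji; first by rewrite (leq_ltn_trans ij ji) rho_homo.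
by case: ltnP => // ii; apply/psi_le_rho/ltnW.
Qed.

Lemma sum_coefficient (X : {set 'I_n}) :
  \sum_(i in X) coefficient i =
    \sum_(i in X | (i < i0)%N) rho i.+1 +
    \sum_(i in X | (i0 <= i < h)%N) psi +
    \sum_(i in X | (h <= i)%N) gamma i.
Proof.
rewrite (bigID (fun i : 'I_n => (i < h)%N)) /=; congr (_ + _); last first.
  apply: eq_big => i; first by rewrite -leqNgt.
  by move=> /andP[_ ih]; rewrite /coefficient !ifN //; lia.
rewrite (bigID (fun i : 'I_n => (i < i0)%N)) /=; congr (_ + _).
  apply: eq_big => i; last by rewrite /coefficient => /andP[_ ->].
  by case: (i \in X) => //=; apply/idP/idP; lia.
apply: eq_big => i; first by case: (i \in X) => //=; apply/idP/idP; lia.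
by move=> /andP[/andP[_ ih] ii]; rewrite /coefficient ifN // ih.
Qed.

Lemma gamma_ofE X :
  gamma_of X = f (aL + \sum_(i in X) a i) - \sum_(i in X) coefficient i.
Proof. by rewrite sum_coefficient /Defs.gamma_of hE !opprD !addrA. Qed.

Lemma sum_indicator (P : pred 'I_n) (x : 'I_n -> bool) (F : 'I_n -> R) :
  \sum_(i < n | P i) F i * (x i)%:R = \sum_(i < n | P i && x i) F i.
Proof.
by rewrite big_mkcondr; apply: eq_bigr => i _; rewrite mulr_natr mulrb.
Qed.

Lemma lifting_objectiveE (j : 'I_n) w (x : {ffun 'I_n -> bool}) :
  (h <= j)%N ->
  lifting_objective k i0 f a aH gamma j (w, x) =
    w - \sum_(i in [set i : 'I_n | (i < j)%N && x i]%SET) coefficient i.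
Proof.
move=> hj; rewrite /lifting_objective hE !sum_indicator sum_coefficient.
rewrite !opprD !addrA; congr (_ - _ - _ - _); apply: eq_bigl => i;
  by rewrite inE; case: (x i); rewrite ?andbF //= ?andbT; apply/idP/idP; lia.
Qed.

Lemma gamma_attained (j : 'I_n) : (h <= j)%N ->
  exists X : {set 'I_n},
    [/\ X \subset firstN n j, (#|X| <= k.-1)%N & gamma_of X <= gamma j].
Proof.
move=> hj; have [[[w x] [fw sx] <-] _] := gammaP hj.
exists [set i : 'I_n | (i < j)%N && x i]%SET; split.
- by apply/fintype.subsetP => i; rewrite !inE => /andP[].
- rewrite -sum1_card (leq_trans _ sx) // big_mkcond [leqRHS]big_mkcond /=.
  by apply: leq_sum => i _; rewrite inE; case: (i < j)%N; case: (x i).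
- rewrite lifting_objectiveE // gamma_ofE lerD2r (le_trans _ fw) //.
  rewrite sum_indicator.
  rewrite (eq_bigl (fun i : 'I_n => (i < j)%N && x i)) //.
  by move=> i; rewrite inE.
Qed.

Lemma gamma_le (j : 'I_n) (X : {set 'I_n}) :
  (h <= j)%N -> X \subset firstN n j -> (#|X| <= k.-1)%N ->
  gamma j <= gamma_of X.
Proof.
move=> hj /fintype.subsetP Xj cX; have [_ le_gamma] := gammaP hj.
pose x : {ffun 'I_n -> bool} := [ffun i => i \in X].
have XE : [set i : 'I_n | (i < j)%N && x i]%SET = X.
  apply/setP => i; rewrite !inE ffunE.
  by case: (boolP (i \in X)) => [/Xj|]; rewrite ?inE ?andbF // => ->.
rewrite (le_trans (le_gamma (f (aL + \sum_(i in X) a i), x) _)) //; last first.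
  by rewrite lifting_objectiveE // XE gamma_ofE.
split.
  rewrite sum_indicator [X in f X <= _](_ : _ = aL + \sum_(i in X) a i) //.
  by congr (_ + _); apply: eq_bigl => i; rewrite -XE inE.
rewrite (leq_trans _ cX) // -sum1_card big_mkcond [leqRHS]big_mkcond /=.
by apply: leq_sum => i _; rewrite ffunE; case: (i < j)%N; case: (i \in X).
Qed.

Lemma gamma_homo (i j : 'I_n) : (h <= i)%N -> (i <= j)%N -> gamma j <= gamma i.
Proof.
move=> hi ij; have [X [/fintype.subsetP Xi cX]] := gamma_attained hi.
apply: le_trans; apply: gamma_le cX; first exact: leq_trans ij.
by apply/fintype.subsetP => p /Xi; rewrite !inE => /leq_trans; apply.
Qed.

Definition prefix_support (u s : nat) : {set 'I_n} :=
  firstL a aH u :|: firstN n s.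

Lemma prefix_supportI u s : (s <= h)%N ->
  prefix_support u s :&: firstN n h = firstN n s.
Proof.
move=> sh; apply/setP => i; rewrite !inE hE; apply/idP/idP; lia.
Qed.

Lemma prefix_supportD u s : (s <= h)%N ->
  prefix_support u s :\: firstN n h = firstL a aH u.
Proof.
move=> sh; apply/setP => i; rewrite !inE hE; apply/idP/idP; lia.
Qed.

Lemma card_firstN s : (s <= n)%N -> #|firstN n s| = s.
Proof. exact: (@card_ord_itv n 0 s). Qed.

Lemma card_firstL u : (h + u <= n)%N -> #|firstL a aH u| = u.
Proof. by rewrite /firstL hE; apply: card_ord_itv. Qed.

Lemma card_prefix_support u s : (s <= h)%N -> (h + u <= n)%N ->
  #|prefix_support u s| = (s + u)%N.
Proof.
move=> sh hun; rewrite -(cardsID (firstN n h)).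
rewrite prefix_supportI // prefix_supportD //.
by rewrite card_firstL // card_firstN // (leq_trans sh).
Qed.

Lemma sum_weight (X : {set 'I_n}) :
  \sum_(i in X) a i = aH *+ #|X :&: firstN n h| + aL *+ #|X :\: firstN n h|.
Proof.
rewrite (big_setID (firstN n h)) /= -!sumr_const; congr (_ + _).
  by apply: eq_bigr => i; rewrite !inE => /andP[_ /weight_H].
by apply: eq_bigr => i; rewrite !inE -leqNgt => /andP[/weight_L].
Qed.

Lemma gamma_of_prefix_support_le (X : {set 'I_n}) :
  gamma_of (prefix_support #|X :\: firstN n h| #|X :&: firstN n h|)
    <= gamma_of X.
Proof.
set u := #|X :\: _|; set s := #|X :&: _|.
have sh : (s <= h)%N.
  by rewrite -[leqRHS](card_firstN h_leqn) subset_leq_card // finset.subsetIr.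
have hun : (h + u <= n)%N.
  rewrite -[X in (X + _)%N](card_firstN h_leqn) -cardsUI.
  have -> : firstN n h :&: (X :\: firstN n h) = finset.set0.
    by apply/setP => i; rewrite !inE; case: (_ < _)%N.
  by rewrite cards0 addn0 -[leqRHS]card_ord max_card.
have cI : #|X :&: firstN n h| = #|firstN n s|.
  by rewrite card_firstN // (leq_trans sh).
have cD : #|X :\: firstN n h| = #|firstL a aH u| by rewrite card_firstL.
rewrite !gamma_ofE !sum_weight prefix_supportI // prefix_supportD //.
rewrite -cI -cD lerD2l lerN2.
rewrite (big_setID (firstN n h)) [leRHS](big_setID (firstN n h)) /=.
rewrite prefix_supportI // prefix_supportD //; apply: lerD.
  apply: ler_sum_exchange => // i j.
  rewrite !inE => /and3P[si _ ih] /andP[_ js].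
  by apply: coefficient_H_homo => //; lia.
apply: ler_sum_exchange => // i j.
rewrite !inE hE => /and3P[ui ih _] /andP[_ ju].
rewrite /coefficient !ifN; try lia.
by apply: gamma_homo; lia.
Qed.

Hypothesis cond : weight_condition k i0 f aL aH.

Lemma gamma_of_setU1_le (i : 'I_n) (X : {set 'I_n}) :
  (i < h)%N -> i \notin X -> firstN n i \subset X ->
  gamma_of (i |: X) <= gamma_of X.
Proof.
move=> ih iX sub; rewrite !gamma_ofE !big_setU1 //= weight_H //.
have wX : i%:R * aH <= \sum_(p in X) a p.
  have in_ : (i <= n)%N by apply: ltnW.
  rewrite (big_setID (firstN n i)) /= (finset.setIidPr sub).
  rewrite -[leLHS]addr0 lerD //.
    rewrite -[in leLHS](card_firstN in_) mulr_natl -sumr_const ler_sum // => p.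
    by rewrite inE => pi; rewrite weight_H // (ltn_trans pi).
  by apply: sumr_ge0 => p _; apply: weight_ge0.
suff : f (aL + \sum_(p in X) a p + aH) - f (aL + \sum_(p in X) a p)
       <= coefficient i.
  by rewrite [aH + _]addrC addrA; lra.
rewrite /coefficient ih; case: ltnP => ii.
  rewrite rhoS -natr1 mulrDl mul1r; apply: concave_increments => //.
  by have := aL0; lra.
apply: le_trans cond; rewrite mulrDl mul1r addrA.
apply: concave_increments => //; rewrite lerD2l (le_trans _ wX) //.
by rewrite ler_wpM2r // ler_nat.
Qed.

Lemma gamma_of_prefix_support_homo u s s' : (s <= s')%N -> (s' <= h)%N ->
  gamma_of (prefix_support u s') <= gamma_of (prefix_support u s).
Proof.
elim: s' => [|s' IH]; first by rewrite leqn0 => /eqP ->.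
rewrite leq_eqVlt => /predU1P[-> //|ss'] sh'.
apply: le_trans (IH _ (ltnW sh')); last by [].
pose i := Ordinal (leq_trans sh' h_leqn).
have -> : prefix_support u s'.+1 = i |: prefix_support u s'.
  apply/setP => p; rewrite !inE hE -val_eqE /=; apply/idP/idP; lia.
apply: gamma_of_setU1_le => //; first by rewrite !inE hE /=; lia.
by apply/fintype.subsetP => p; rewrite !inE => ->; rewrite orbT.
Qed.

Lemma gamma_le_prefix_support (t u : nat) (j : 'I_n) :
  j = (h + t)%N :> nat -> (u <= t)%N -> (u <= k.-1)%N ->
  gamma j <= gamma_of (prefix_support u (k.-1 - u)).
Proof.
move=> jt ut uk; have jn := ltn_ord j; apply: gamma_le; first by lia.
  by apply/fintype.subsetP => p; rewrite !inE hE; lia.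
by rewrite card_prefix_support; lia.
Qed.

Lemma prefix_support_optimal (t : nat) (j : 'I_n) :
  j = (h + t)%N :> nat ->
  exists u, [/\ (u <= t)%N, (u <= k.-1)%N
    & gamma_of (prefix_support u (k.-1 - u)) <= gamma j].
Proof.
move=> jt; have hj : (h <= j)%N by rewrite jt leq_addr.
have [X [Xj cX le_gamma]] := gamma_attained hj.
have cID := cardsID (firstN n h) X.
exists #|X :\: firstN n h|; split; last 1 first.
- apply: le_trans le_gamma; apply: le_trans (gamma_of_prefix_support_le X).
  by apply: gamma_of_prefix_support_homo; lia.
- have : X :\: firstN n h \subset firstL a aH t.
    apply/fintype.subsetP => i; rewrite !inE -leqNgt => /andP[hi iX].
    by move/fintype.subsetP/(_ _ iX): Xj; rewrite inE hE hi jt.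
  by move/subset_leq_card; rewrite card_firstL // -jt ltnW.
- by lia.
Qed.

End TwoWeightLifting.

Theorem proposition4p16 (R : realType) (n k i0 : nat) (f : R -> R)
    (a : 'I_n -> R) (aL aH : R) (gamma : 'I_n -> R)
    (hk : (1 <= k)%N)
    (hconc : concave_function f) (hf0 : f 0 = 0)
    (hweights : two_weights a aL aH)
    (hindex : natural_indexing a aL aH)
    (hH : (k < #|itemsH a aH|)%N)
    (hi0 : (i0 < k)%N)
    (hgamma : lifting_coefficients k i0 f a aL aH gamma) :
  (i0 = k.-1 -> weight_condition k i0 f aL aH) /\
  (weight_condition k i0 f aL aH ->
    (forall j : 'I_n, j = #|itemsH a aH| :> nat ->
       gamma j = gamma_of k i0 f a aL aH gamma (firstN n k.-1)) /\
    (forall (t : nat) (j j' : 'I_n), (1 <= t)%N ->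
       j = (#|itemsH a aH| + t)%N :> nat ->
       j' = (#|itemsH a aH| + t).-1 :> nat ->
       gamma j =
         if (t < k)%N
         then Num.min (gamma j')
                (gamma_of k i0 f a aL aH gamma
                   (firstL a aH t :|: firstN n (k.-1 - t))%SET)
         else gamma j')).
Proof.
have [aL0 _ _ _ _] := hweights.
split.
  move=> ik; rewrite /weight_condition ik /psi.
  have -> : k%:R - k.-1%:R = 1 :> R.
    by rewrite -[in k%:R](prednK hk) -natr1 [_ + 1]addrC addrK.
  rewrite divr1 -[in k%:R](prednK hk) -natr1 mulrDl mul1r addrA.
  have aH0 : 0 <= aH.
    by case: hweights => a0 aLH _ _ _; rewrite (le_trans a0) // ltW.
  by apply: concave_increments => //; lra.
have [h hE] : exists h, #|itemsH a aH| = h by eexists.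
rewrite !hE in hH *; move=> cond.
have le_prefix := gamma_le_prefix_support hE hk hweights hH hi0 hgamma.
have optimal :=
  prefix_support_optimal hE hk hconc hweights hindex hH hi0 hgamma cond.
split=> [j jh|t j j' t0 jt jt'].
  have j0 : j = (h + 0)%N :> nat by rewrite addn0.
  have E : prefix_support a aH 0 (k.-1 - 0) = firstN n k.-1.
    by apply/setP => i; rewrite !inE hE; apply/idP/idP; lia.
  have [u [u0 _]] := optimal _ _ j0.
  move: u0; rewrite leqn0 => /eqP ->; rewrite E => le_j.
  apply/eqP; rewrite eq_le le_j andbT -E.
  exact: le_prefix j0 _ _.
have j'E : j' = (h + t.-1)%N :> nat by rewrite jt'; lia.
have jj' : gamma j <= gamma j'.
  by apply: (gamma_homo hE hk hweights hH hi0 hgamma); lia.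
have [u [ut uk le_j]] := optimal _ _ jt.
apply/eqP; rewrite eq_le; apply/andP; split.
  case: ifP => // tk; rewrite le_min jj' /=.
  by apply: le_prefix jt _ _; lia.
have [utE|ut'] := eqVneq u t.
  rewrite ifT; last by lia.
  by rewrite ge_min -utE le_j orbT.
apply: (@le_trans _ _ (gamma j')).
  by case: ifP => // _; rewrite ge_min lexx.
by apply: le_trans le_j; apply: le_prefix j'E _ _; lia.
Qed.
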